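(* Let $\mathcal{E}=(\mathcal{U},\tilde\varphi,\mathcal{J})$ be an exchangeability system. Each of the following two conditions implies the weak singleton condition (and also the extended weak singleton condition) for $\mathcal{E}$. (a) The state $\tilde\varphi$ is faithful and the exchangeability system comes from an amalgamated free product, i.e. $\mathcal{E}=(\mathcal{U},\varphi\circ\tilde\psi,\mathcal{J})$, where $(\mathcal{A},\psi)$ is a $\mathcal{B}$-valued noncommutative probability space, $(\mathcal{U},\tilde\psi)=\bigstar_{\mathcal{B}}(\mathcal{A}_i,\psi_i)$ is the free product with amalgamation over $\mathcal{B}$ of infinitely many copies $(\mathcal{A}_i,\psi_i)_{i\in\mathbf{N}}$ of $(\mathcal{A},\psi)$, $\mathcal{J}$ is the family of natural embeddings $\mathcal{A}\to\mathcal{A}_i\subseteq\mathcal{U}$, $\varphi$ is a state on $\mathcal{B}$, and $\tilde\varphi=\varphi\circ\tilde\psi$. (b) The state $\tilde\varphi$ is tracial.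
   Context: All algebras are unital complex $C^*$- or pre-$C^*$-algebras. A noncommutative probability space is a pair $(\mathcal{A},\varphi)$ of such an algebra and a state $\varphi$ on it. A $\mathcal{B}$-valued noncommutative probability space is a pair $(\mathcal{A},\psi)$ with $\psi$ a conditional expectation of $\mathcal{A}$ onto a unital subalgebra $\mathcal{B}\subseteq\mathcal{A}$, i.e. a unital positive map $\psi:\mathcal{A}\to\mathcal{B}$ with $\psi(BXB')=B\psi(X)B'$ for $B,B'\in\mathcal{B}$, $X\in\mathcal{A}$. In (a), $\mathcal{E}$ is regarded as a (scalar-valued) exchangeability system for $(\mathcal{A},\varphi\circ\psi)$. Exchangeability system. An exchangeability system $\mathcal{E}=(\mathcal{U},\tilde\varphi,\mathcal{J})$ for $(\mathcal{A},\varphi)$ consists of a noncommutative probability space $(\mathcal{U},\tilde\varphi)$ and an infinite family $\mathcal{J}=(\iota_k)_{k\in\mathbf{N}}$ of state-preserving embeddings ($*$-homomorphisms with $\tilde\varphi\circ\iota_k=\varphi$) $\iota_k:\mathcal{A}\to\mathcal{A}_k\subseteq\mathcal{U}$, written $X\mapsto X^{(k)}$, such that for all $n$, $X_1,\dots,X_n\in\mathcal{A}$, $h:\{1,\dots,n\}\to\mathbf{N}$ and $\sigma\in\mathfrak{S}_\infty$ (permutations of $\mathbf{N}$) $$\tilde\varphi(X_1^{(h(1))}\cdots X_n^{(h(n))})=\tilde\varphi(X_1^{(\sigma(h(1)))}\cdots X_n^{(\sigma(h(n)))}).$$ It is assumed that $\mathcal{U}$ is generated by the algebras $\mathcal{A}_k$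 and that the action $\sigma(X^{(k)})=X^{(\sigma(k))}$ of $\mathfrak{S}_\infty$ extends to all of $\mathcal{U}$ leaving $\tilde\varphi$ invariant. Weak singleton condition. For all $n$, $X_1,\dots,X_n\in\mathcal{A}$ and indices $i_1,\dots,i_n\in\mathbf{N}$: $\tilde\varphi(X_1^{(i_1)}\cdots X_n^{(i_n)})=0$ whenever, for some $j$, the index $i_j$ appears only once among $i_1,\dots,i_n$ and $\tilde\varphi((X_j^{(1)})^*X_j^{(2)})=0$. Extended weak singleton condition. For $I\subseteq\mathbf{N}$ let $\mathcal{A}_I$ be the algebra generated by $(\mathcal{A}_i)_{i\in I}$. Given a sequence $(I_j)_{j\in\mathbf{N}}$ of mutually disjoint subsets of $\mathbf{N}$ of the same cardinality as $I$ and bijections $I\to I_j$, let $W\mapsto W^{(I_j)}$ be the induced permutation isomorphism $\mathcal{A}_I\to\mathcal{A}_{I_j}$. The condition is: for every finite $I\subseteq\mathbf{N}$ and all $W_1,\dots,W_n\in\mathcal{A}_I$ (polynomials in elements of the $\mathcal{A}_i$, $i\in I$) one has $\tilde\varphi(W_1^{(I_{i_1})}\cdots W_n^{(I_{i_n})})=0$ whenever, for some $j$, the index $i_j$ appears only once among $i_1,\dots,i_n$ and $\tilde\varphi((W_j^{(I_1)})^*W_j^{(I_2)})=0$. *)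

(* Defs.v *)
From HB Require Import structures.
From mathcomp Require Import all_boot all_order all_algebra.
From mathcomp Require Import complex.
From mathcomp Require Import all_classical all_reals.

Set Implicit Arguments.
Unset Strict Implicit.
Unset Printing Implicit Defensive.

Import Order.TTheory GRing.Theory Num.Theory.

Local Open Scope classical_set_scope.
Local Open Scope ring_scope.

(** Unital pre-C*-algebras: unital *-algebras with a C*-norm.  Completeness is
    not required, so C*-algebras are the complete instances.  The scalars
    [C : numClosedFieldType] are meant to be [R[i]] with [R : realType].  The
    norm takes (real) values in [C]; it is a field of the mixin because
    [NormedModule] cannot be joined with the ring structures. *)
HB.mixin Record isPreCStarAlgebra (C : numClosedFieldType) A
    & GRing.Algebra C A := {
  star : A -> A;
  starK : involutive star;
  starD : {morph star : x y / x + y};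
  starZ : forall (a : C) (x : A), star (a *: x) = a^* *: star x;
  starM : forall x y : A, star (x * y) = star y * star x;
  cnorm : A -> C;
  cnormD_le : forall x y : A, cnorm (x + y) <= cnorm x + cnorm y;
  cnormZ : forall (a : C) (x : A), cnorm (a *: x) = `|a| * cnorm x;
  cnorm0_eq0 : forall x : A, cnorm x = 0 -> x = 0;
  cnormM_le : forall x y : A, cnorm (x * y) <= cnorm x * cnorm y;
  cnorm_starM : forall x : A, cnorm (star x * x) = cnorm x ^+ 2
}.

#[short(type="preCStarAlgType")]
HB.structure Definition PreCStarAlgebra (C : numClosedFieldType) :=
  { A of GRing.Algebra C A & isPreCStarAlgebra C A }.

Section PreCStarAlgebras.
Variable C : numClosedFieldType.
Implicit Types A B U : preCStarAlgType C.

(** Unitality is part of [lrmorphism].  Injective *-homomorphisms between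
    C*-algebras are automatically isometric. *)
Definition star_embedding A B (f : {lrmorphism A -> B}) : Prop :=
  (forall x, f (star x) = star (f x)) /\ injective f.

Definition norm_closure A (S : set A) : set A :=
  [set x | forall e : C, 0 < e -> exists2 y, S y & cnorm (x - y) < e].

Definition norm_dense A (S : set A) : Prop := norm_closure S = [set: A].

(** In a C*-algebra the elements [star y * y] form a closed cone; taking the
    closure amounts to positivity in the completion for a pre-C*-algebra. *)
Definition positive_elt A (x : A) : Prop :=
  norm_closure [set star y * y | y in [set: A]] x.

(** [0 <= z] in [C] means that [z] is real and nonnegative. *)
Record state A := State {
  state_fun :> {scalar A};
  state_unital : state_fun 1 = 1;
  state_ge0 : forall x, 0 <= state_fun (star x * x)
}.

Definition faithful A (phi : state A) : Prop :=
  forall x, phi (star x * x) = 0 -> x = 0.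

Definition tracial A (phi : state A) : Prop :=
  forall x y, phi (x * y) = phi (y * x).

Definition generated_subalgebra A (S : set A) : set A :=
  smallest [set V : set A | GRing.subalg_closed (mem V)] S.

(** A conditional expectation of [A] onto a unital subalgebra, which is the
    image of [B] under [ce_incl]. *)
Record cond_expectation B A := CondExpectation {
  ce_incl : {lrmorphism B -> A};
  ce_incl_embedding : star_embedding ce_incl;
  ce_fun :> {linear A -> B};
  ce_unital : ce_fun 1 = 1;
  ce_positive : forall x, positive_elt (ce_fun (star x * x));
  ce_bimodule : forall b x b',
    ce_fun (ce_incl b * x * ce_incl b') = b * ce_fun x * b'
}.

Definition free_over B I (A : I -> preCStarAlgType C)
    (psi : forall i, cond_expectation B (A i)) U
    (Psi : cond_expectation B U) (iota : forall i, {lrmorphism A i -> U}) :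
    Prop :=
  forall n (i : 'I_n.+1 -> I) (X : forall k, A (i k)),
    (forall k l : 'I_n.+1, l = k.+1 :> nat -> i k <> i l) ->
    (forall k, psi (i k) (X k) = 0) ->
    Psi (\prod_(k < n.+1) iota (i k) (X k)) = 0.

(** [(U, Psi)], with the embeddings [iota i], is the free product of the
    [(A i, psi i)] with amalgamation over [B].  Density of the algebra
    generated by the [A i] allows [U] to be the algebraic free product as well
    as a C*-completion.  [afp_reduced] says that the GNS representation of
    [Psi] is faithful; it follows from faithfulness of [Psi]. *)
Record amalgamated_free_product B I (A : I -> preCStarAlgType C)
    (psi : forall i, cond_expectation B (A i)) U
    (Psi : cond_expectation B U) (iota : forall i, {lrmorphism A i -> U}) :
    Prop := AmalgamatedFreeProduct {
  afp_embedding : forall i, star_embedding (iota i);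
  afp_amalgamated : forall i b, iota i (ce_incl (psi i) b) = ce_incl Psi b;
  afp_expectation : forall i x, Psi (iota i x) = psi i x;
  afp_free : free_over psi Psi iota;
  afp_generated :
    norm_dense (generated_subalgebra (\bigcup_i range (iota i)));
  afp_reduced : forall x,
    (forall y, Psi (star (x * y) * (x * y)) = 0) -> x = 0
}.

(** [es_act] is only meaningful on permutations of [nat]. *)
Record exchangeability_system A (phi : state A) := ExchangeabilitySystem {
  es_alg : preCStarAlgType C;
  es_state : state es_alg;
  es_iota : nat -> {lrmorphism A -> es_alg};
  es_embedding : forall k, star_embedding (es_iota k);
  es_state_iota : forall k x, es_state (es_iota k x) = phi x;
  es_exchangeable :
    forall n (X : 'I_n -> A) (h : 'I_n -> nat) (s : nat -> nat), bijective s ->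
      es_state (\prod_(j < n) es_iota (h j) (X j)) =
      es_state (\prod_(j < n) es_iota (s (h j)) (X j));
  es_generated :
    norm_dense (generated_subalgebra (\bigcup_k range (es_iota k)));
  es_act : (nat -> nat) -> {lrmorphism es_alg -> es_alg};
  es_act_star : forall s, bijective s ->
    forall u, es_act s (star u) = star (es_act s u);
  es_act_id : forall u, es_act id u = u;
  es_act_comp : forall s t, bijective s -> bijective t ->
    forall u, es_act (s \o t) u = es_act s (es_act t u);
  es_act_iota : forall s, bijective s ->
    forall k x, es_act s (es_iota k x) = es_iota (s k) x;
  es_act_state : forall s, bijective s ->
    forall u, es_state (es_act s u) = es_state u
}.

Section Singleton.
Variables (A : preCStarAlgType C) (phi : state A).
Variable E : exchangeability_system phi.

Definition appears_once n (i : 'I_n -> nat) (j : 'I_n) : Prop :=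
  forall k, i k = i j -> k = j.

Definition weak_singleton : Prop :=
  forall n (X : 'I_n -> A) (i : 'I_n -> nat) (j : 'I_n),
    appears_once i j ->
    es_state E (star (es_iota E 1%N (X j)) * es_iota E 2%N (X j)) = 0 ->
    es_state E (\prod_(k < n) es_iota E (i k) (X k)) = 0.

Definition es_subalgebra (I : set nat) : set (es_alg E) :=
  generated_subalgebra (\bigcup_(k in I) range (es_iota E k)).

(** [beta l] is the bijection from [I] onto [I_ l].  As [I] is finite, it
    extends to a permutation [s l] of [nat], and the induced isomorphism
    [W |-> W^(I_ l)] from [es_subalgebra I] onto [es_subalgebra (I_ l)] is the
    restriction of [es_act E (s l)], whatever the extension. *)
Definition extended_weak_singleton : Prop :=
  forall (I : set nat) (I_ : nat -> set nat) (beta s : nat -> nat -> nat),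
    finite_set I ->
    trivIset [set: nat] I_ ->
    (forall l, set_bij I (I_ l) (beta l)) ->
    (forall l, bijective (s l) /\ {in I, s l =1 beta l}) ->
    forall n (W : 'I_n -> es_alg E) (i : 'I_n -> nat) (j : 'I_n),
      (forall k, es_subalgebra I (W k)) ->
      appears_once i j ->
      es_state E (star (es_act E (s 1%N) (W j)) * es_act E (s 2%N) (W j)) = 0 ->
      es_state E (\prod_(k < n) es_act E (s (i k)) (W k)) = 0.

(** Here [A] is a [B]-valued space [(A, psi)], [phi] is the state induced by
    the state [phiB] on [B], and the [k]-th copy of [(A, psi)] is [(A, psi)]
    itself, embedded by [es_iota E k]. *)
Definition from_amalgamated_free_product : Prop :=
  exists (B : preCStarAlgType C) (psi : cond_expectation B A)
      (Psi : cond_expectation B (es_alg E)) (phiB : state B),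
    [/\ amalgamated_free_product (fun _ : nat => psi) Psi (es_iota E),
        forall x, phi x = phiB (psi x) &
        forall u, es_state E u = phiB (Psi u)].

End Singleton.

End PreCStarAlgebras.

(* Main.v *)
Require Import Defs.
From mathcomp Require Import all_boot all_order all_algebra.
From mathcomp Require Import ring complex.
From mathcomp Require Import all_classical all_reals.

(** Both conditions are used through one reduction.  Let [X] be the factor
    whose index appears once, moved to its own block of indices.  The other
    factors lie in algebras [A_J] with [J] finite and disjoint from that block,
    so the moment in question has the form [phi (Y * X * Z)] with [Y] and [Z]
    in [A_J]; [block_singleton] says that it vanishes.  It implies the extended
    weak singleton condition, and the weak condition is the case of the block
    [I = {0}], moved to [{l}] by the transposition of [0] and [l].

    In the tracial case, [phi (Y * X * Z) = phi (Z * Y * X)].  Permutations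
    that fix [J] pointwise move [X] to infinitely many pairwise disjoint
    blocks.  By invariance the translates [X_m] all have the same value of
    [phi (Z * Y * X_m)] and the same length in the semi-inner product
    [phi (x^* y)], and the hypothesis [phi (X^(I_1)^* X^(I_2)) = 0] makes them
    orthogonal.  By Cauchy-Schwarz the average of the first [n] of them has
    length tending to [0], so the common value is [0]
    ([state_orthogonal_sequence], [tracial_block_singleton]).

    In the free product case, let [Psi] be the conditional expectation onto
    [B].  Faithfulness of [phi = phiB \o Psi] makes [Psi] commute with the
    involution and invariant under permutations.  Algebras over disjoint index
    sets are free over [B], so [phi (W^(I_1)^* W^(I_2))] equals
    [phiB (Psi(W)^* Psi(W))], and its vanishing forces [Psi W = 0].  Freeness
    again gives [Psi (Y * X * Z) = 0] when [Psi X = 0]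
    ([ce_free_mul], [ce_free_sandwich]).  Freeness of the grouped algebras is
    obtained by writing their elements as sums of alternating products of
    centered elements with a coefficient in [B] on the left. *)

Set Implicit Arguments.
Unset Strict Implicit.
Unset Printing Implicit Defensive.

Import Order.TTheory GRing.Theory Num.Theory.

Local Open Scope classical_set_scope.
Local Open Scope ring_scope.

(** * Generated subalgebras *)

Section GeneratedSubalgebra.
Variable C : numClosedFieldType.
Implicit Types A U : preCStarAlgType C.

Lemma generated_subalgebra_closed A (S : set A) :
  GRing.subalg_closed (mem (generated_subalgebra S)).
Proof.
split; first by apply/mem_set => V [[V1 _ _] _]; move: V1; rewrite inE.
- move=> a u v /set_mem Su /set_mem Sv; apply/mem_set => V VS.
  have [[_ VL _] _] := VS.
  have := VL a u v; rewrite !inE; apply; [exact: Su|exact: Sv].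
- move=> u v /set_mem Su /set_mem Sv; apply/mem_set => V VS.
  have [[_ _ VM] _] := VS.
  have := VM u v; rewrite !inE; apply; [exact: Su|exact: Sv].
Qed.

Section Closure.
Variables (A : preCStarAlgType C) (S : set A).

Lemma generated1 : generated_subalgebra S 1.
Proof. by have [/set_mem] := generated_subalgebra_closed S. Qed.

Lemma generated_linear a u v : generated_subalgebra S u ->
  generated_subalgebra S v -> generated_subalgebra S (a *: u + v).
Proof.
move=> Su Sv; have [_ SL _] := generated_subalgebra_closed S.
by apply/set_mem/SL; apply/mem_set.
Qed.

Lemma generatedM u v : generated_subalgebra S u ->
  generated_subalgebra S v -> generated_subalgebra S (u * v).
Proof.
move=> Su Sv; have [_ _ SM] := generated_subalgebra_closed S.
by apply/set_mem/SM; apply/mem_set.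
Qed.

Lemma generated_incl : S `<=` generated_subalgebra S.
Proof. exact: sub_gen_smallest. Qed.

(** The elimination principle of [generated_subalgebra], with the closure
    conditions stated for sets instead of boolean predicates. *)
Lemma generated_min (V : set A) : V 1 ->
    (forall a u v, V u -> V v -> V (a *: u + v)) ->
    (forall u v, V u -> V v -> V (u * v)) ->
  S `<=` V -> generated_subalgebra S `<=` V.
Proof.
move=> V1 VL VM; apply: smallest_sub; split; first exact: mem_set.
- by move=> a u v /set_mem Vu /set_mem Vv; apply/mem_set/VL.
- by move=> u v /set_mem Vu /set_mem Vv; apply/mem_set/VM.
Qed.

Lemma generated_prod (K : eqType) (r : seq K) (F : K -> A) :
    (forall k, k \in r -> generated_subalgebra S (F k)) ->
  generated_subalgebra S (\prod_(k <- r) F k).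
Proof.
move=> SF; rewrite big_seq; elim/big_ind: _ => //; first exact: generated1.
exact: generatedM.
Qed.

End Closure.

Lemma generated_lrmorph A U (f : {lrmorphism A -> U}) (S : set A) (T : set U) :
    (forall x, S x -> generated_subalgebra T (f x)) ->
  forall x, generated_subalgebra S x -> generated_subalgebra T (f x).
Proof.
move=> ST x; apply: (@generated_min _ S
  (fun x => generated_subalgebra T (f x))) => //.
- by rewrite rmorph1; exact: generated1.
- by move=> a u v Tu Tv; rewrite linearP; exact: generated_linear.
- by move=> u v Tu Tv; rewrite rmorphM; exact: generatedM.
Qed.

Lemma star1 A : star (1 : A) = 1.
Proof. by rewrite -[RHS]starK -[star 1 in RHS]mul1r starM starK mul1r. Qed.

Lemma generated_star A (S : set A) :
    (forall x, S x -> S (star x)) ->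
  forall x, generated_subalgebra S x -> generated_subalgebra S (star x).
Proof.
move=> SS x; apply: (@generated_min _ S
  (fun x => generated_subalgebra S (star x))) => //.
- by rewrite star1; exact: generated1.
- by move=> a u v Tu Tv; rewrite starD starZ; exact: generated_linear.
- by move=> u v Tu Tv; rewrite starM; exact: generatedM.
- by move=> u /SS; exact: generated_incl.
Qed.

End GeneratedSubalgebra.

(** * States *)

Section States.
Variables (C : numClosedFieldType) (A : preCStarAlgType C) (phi : state A).
Implicit Types x y : A.

Lemma state_quadratic x y (a : C) :
  phi (star (x + a *: y) * (x + a *: y)) =
    phi (star x * x) + a * phi (star x * y) + a^* * phi (star y * x)
    + a * a^* * phi (star y * y).
Proof.
rewrite starD starZ mulrDl !mulrDr -!scalerAr -!scalerAl !linearD !linearZ /=.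
by rewrite !addrA mulrA.
Qed.

(** Positivity at [x + a *: y] makes [a * p + a^* * q] real for every [a],
    where [p] and [q] are the two mixed terms; [a = 1] and [a = 'i] together
    give [q = p^*]. *)
Lemma state_conj x y : phi (star y * x) = (phi (star x * y))^*.
Proof.
have real_phi z : (phi (star z * z))^* = phi (star z * z).
  by apply: conj_Creal; apply: ger0_real; exact: state_ge0.
set p := phi (star x * y); set q := phi (star y * x).
have E a : a * p + a^* * q = a^* * p^* + a * q^*.
  have := real_phi (x + a *: y); rewrite state_quadratic -/p -/q.
  rewrite !rmorphD !rmorphM /= !conjCK !real_phi [a^* * a]mulrC => /addIr.
  by rewrite -!addrA => /addrI ->.
have := E 1; have := E 'i; rewrite conjCi conjC1 !mul1r !mulNr => Ei E1.
have {}Ei : p - q = - p^* + q^*.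
  by apply: (mulfI (neq0Ci C)); rewrite mulrBr Ei mulrDr mulrN.
apply/eqP; rewrite -(inj_eq (mulIf (_ : 2 != 0 :> C))) ?pnatr_eq0 //.
rewrite !mulr_natr !mulr2n -subr_eq0; apply/eqP.
transitivity (p + q - (p - q) - p^* - p^*); last by rewrite E1 Ei; ring.
by ring.
Qed.

Lemma state_star x : phi (star x) = (phi x)^*.
Proof. by rewrite -[star x]mulr1 state_conj star1 mul1r. Qed.

(** Positivity at [x - t p^* y] with [t >= 0] and [p = phi (star x * y)].  When
    [phi (star y * y) = d != 0] take [t = 1 / d].  When [d = 0] the
    expression is affine in [t], so it is negative for large [t] unless
    [p = 0]. *)
Lemma state_cauchy_schwarz x y :
  `|phi (star x * y)| ^+ 2 <= phi (star x * x) * phi (star y * y).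
Proof.
set p := phi (star x * y); set a := phi (star x * x); set d := phi (star y * y).
have a0 : 0 <= a by exact: state_ge0.
have d0 : 0 <= d by exact: state_ge0.
have Q (t : C) : 0 <= t -> 0 <= a - 2 * t * `|p| ^+ 2 + t ^+ 2 * `|p| ^+ 2 * d.
  move=> t0; have := state_ge0 phi (x + (- t * p^*) *: y).
  rewrite state_quadratic (state_conj x y) -/p -/a -/d.
  rewrite rmorphM rmorphN /= conjCK (conj_Creal (ger0_real t0)) normCK.
  by congr (_ <= _); ring.
have [d_eq0|dn0] := eqVneq d 0; last first.
  have := Q d^-1; rewrite invr_ge0 => /(_ d0).
  rewrite -(pmulr_lge0 _ (_ : 0 < d)) ?lt_def ?dn0 //.
  have -> : (a - 2 * d^-1 * `|p| ^+ 2 + d^-1 ^+ 2 * `|p| ^+ 2 * d) * d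
     = a * d - `|p| ^+ 2 by field.
  by rewrite subr_ge0.
rewrite d_eq0 mulr0.
have [->|pn0] := eqVneq p 0; first by rewrite normr0 expr0n.
(* This [t] turns the affine expression into [- (a + 2)]. *)
have := Q ((a + 1) / `|p| ^+ 2).
have -> : 0 <= (a + 1) / `|p| ^+ 2 by rewrite divr_ge0 ?addr_ge0 ?exprn_ge0.
move/(_ isT); rewrite d_eq0 mulr0 addr0.
have -> : a - 2 * ((a + 1) / `|p| ^+ 2) * `|p| ^+ 2 = - (a + 2).
  by field; rewrite normr_eq0.
by rewrite oppr_ge0 lt_geF ?ltr_wpDl.
Qed.

End States.

(** * Permutations of the integers *)

Definition swap (a b x : nat) : nat :=
  if x == a then b else if x == b then a else x.

Lemma swapK a b : involutive (swap a b).
Proof.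
move=> x; rewrite /swap; have [->|xa] := eqVneq x a.
  by rewrite eqxx; case: eqVneq.
by have [->|xb] := eqVneq x b; rewrite ?eqxx // (negPf xa) (negPf xb).
Qed.

Lemma swap_bij a b : bijective (swap a b).
Proof. exact: inv_bij (@swapK a b). Qed.

Lemma swapl a b : swap a b a = b.
Proof. by rewrite /swap eqxx. Qed.

Lemma swap_id a b x : x != a -> x != b -> swap a b x = x.
Proof. by rewrite /swap => /negPf -> /negPf ->. Qed.

(** A permutation can be prescribed on finitely many points: if [s] is right on
    [l], composing it with the transposition of [s (f x)] and [g x] corrects the
    point [x], and injectivity of [f] and [g] keeps it right on [l]. *)
Lemma finite_injection_extends (T : eqType) (l : seq T) (f g : T -> nat) :
    {in l &, injective f} -> {in l &, injective g} ->
  exists2 s : nat -> nat, bijective s & {in l, forall x, s (f x) = g x}.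
Proof.
elim: l => [|x l IHl] injf injg; first by exists id => //; exists id.
have subl : {subset l <= x :: l} by move=> y; rewrite inE orbC => ->.
have [s s_bij sfg] := IHl (sub_in2 subl injf) (sub_in2 subl injg).
exists (swap (s (f x)) (g x) \o s) => [|y].
  exact: bij_comp (swap_bij _ _) s_bij.
have [-> _|yx ly] := eqVneq y x; first by rewrite /= swapl.
have {ly} yl : y \in l by move: ly; rewrite inE (negPf yx).
have [ly lx] := (subl _ yl, mem_head x l).
rewrite /= swap_id ?(sfg y) //; last by apply: contra_neq yx; exact: injg.
by rewrite -(sfg y) //; apply: contra_neq yx => /(bij_inj s_bij); exact: injf.
Qed.

(** The form in which permutations are needed: moving a pair of disjoint blocks
    to another such pair. *)
Lemma two_block_permutation (I J : set nat) (f f' g g' : nat -> nat) :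
    finite_set I -> finite_set J ->
    injective f -> injective f' -> injective g -> injective g' ->
    (forall x y, I x -> J y -> f x <> f' y) ->
    (forall x y, I x -> J y -> g x <> g' y) ->
  exists2 s : nat -> nat, bijective s &
    (forall x, I x -> s (f x) = g x) /\ (forall y, J y -> s (f' y) = g' y).
Proof.
move=> /finite_seqP[p ->] /finite_seqP[q ->] injf injf' injg injg' /= ff' gg'.
pose l : seq (nat + nat) := map inl p ++ map inr q.
have lP (h h' : nat -> nat) : injective h -> injective h' ->
    (forall x y, x \in p -> y \in q -> h x <> h' y) ->
    {in l &, injective (fun u : nat + nat =>
      match u with inl x => h x | inr y => h' y end)}.
  move=> injh injh' hh' u v; rewrite !mem_cat.
  case/orP=> /mapP[x xp ->] /orP[] /mapP[y yq ->].
  - by move=> /injh ->.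
  - by move=> /(hh' _ _ xp yq).
  - by move=> /esym /(hh' _ _ yq xp).
  - by move=> /injh' ->.
have [s s_bij sE] := finite_injection_extends
  (lP _ _ injf injf' ff') (lP _ _ injg injg' gg').
exists s => //; split=> x xp.
  by apply: (sE (inl x)); rewrite mem_cat map_f.
by apply: (sE (inr x)); rewrite mem_cat map_f ?orbT.
Qed.

Lemma finite_set_lt (J : set nat) : finite_set J ->
  exists M : nat, forall x, J x -> (x < M)%N.
Proof.
move=> /finite_seqP[r ->]; exists (\max_(x <- r) x).+1 => x /= xr.
by rewrite ltnS; exact: leq_bigmax_seq.
Qed.

(** * Reduction to disjoint blocks *)

Section Exchangeability.
Variables (C : numClosedFieldType) (A : preCStarAlgType C) (phi : state A).
Variable E : exchangeability_system phi.
Implicit Types (I J : set nat) (s t : nat -> nat) (W Q : es_alg E).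

Lemma es_subalgebraS I J W :
  I `<=` J -> es_subalgebra I W -> es_subalgebra J W.
Proof.
move=> IJ; apply: (@generated_lrmorph _ _ _ idfun) => u [k Ik ku].
by apply: generated_incl; exists k => //; exact: IJ.
Qed.

Lemma es_subalgebra_star I W : es_subalgebra I W -> es_subalgebra I (star W).
Proof.
apply: generated_star => u [k Ik [x _ <-]]; exists k => //.
by exists (star x); rewrite // (es_embedding E k).1.
Qed.

Lemma es_act_subalgebra s I W : bijective s ->
  es_subalgebra I W -> es_subalgebra (s @` I) (es_act E s W).
Proof.
move=> s_bij; apply: generated_lrmorph => u [k Ik [x _ <-]].
apply: generated_incl; exists (s k); first by exists k.
by rewrite es_act_iota.
Qed.

Lemma es_act_eq s t I W : bijective s -> bijective t ->
    (forall k, I k -> s k = t k) ->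
  es_subalgebra I W -> es_act E s W = es_act E t W.
Proof.
move=> s_bij t_bij st.
apply: (@generated_min _ _ _ (fun W => es_act E s W = es_act E t W)).
- by rewrite !rmorph1.
- by move=> a u v uE vE; rewrite !linearP /= uE vE.
- by move=> u v uE vE; rewrite !rmorphM /= uE vE.
- by move=> u [k Ik [x _ <-]]; rewrite !es_act_iota // st.
Qed.

Lemma es_act_fix s I W : bijective s -> (forall k, I k -> s k = k) ->
  es_subalgebra I W -> es_act E s W = W.
Proof.
move=> s_bij s_id IW; rewrite -[RHS]es_act_id.
by apply: es_act_eq IW => //; exists id.
Qed.

(** [J] carries all the factors other than the distinguished one, so the
    bookkeeping of indices is gone; this is the statement proved from each of
    the two conditions. *)
Definition block_singleton : Prop :=
  forall I J (s s1 s2 : nat -> nat) W Y Z,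
    finite_set I -> finite_set J ->
    bijective s -> bijective s1 -> bijective s2 ->
    (forall x y, I x -> J y -> s x <> y) ->
    (forall x y, I x -> I y -> s1 x <> s2 y) ->
    es_subalgebra I W -> es_subalgebra J Y -> es_subalgebra J Z ->
    es_state E (star (es_act E s1 W) * es_act E s2 W) = 0 ->
    es_state E (Y * es_act E s W * Z) = 0.

(** The product is split at the factor [j].  As the index of [j] appears once,
    the factors on either side lie over the union of the blocks other than
    [I_ (i j)]. *)
Lemma block_singleton_extended : block_singleton -> extended_weak_singleton E.
Proof.
move=> H I I_ beta s finI disj bij sP n W i j IW once W0.
have sI l x : I x -> I_ l (s l x).
  by move=> Ix; have [sub _ _] := bij l; rewrite (sP l).2 ?inE //; exact: sub.
have disjoint l l' x : I_ l x -> I_ l' x -> l = l'.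
  by move=> lx l'x; apply: disj => //; exists x.
pose J := \bigcup_(k in [set k | k <> j]) I_ (i k).
have finJ : finite_set J.
  apply: bigcup_finite => // k _.
  have [sub _ surj] := bij (i k); apply: sub_finite_set surj _.
  exact: finite_image.
have JW k : k <> j -> es_subalgebra J (es_act E (s (i k)) (W k)).
  move=> kj; apply: es_subalgebraS (es_act_subalgebra (sP _).1 (IW k)).
  move=> y [x Ix <-].
  by exists k => //; exact: sI.
have JP r : j \notin r ->
    es_subalgebra J (\prod_(k <- r) es_act E (s (i k)) (W k)).
  move=> jr; apply: generated_prod => k kr; apply: JW => kj.
  by move: jr; rewrite -kj kr.
set r := index_enum _; have jr : j \in r by exact: mem_index_enum.
have r_uniq : uniq r by exact: index_enum_uniq.
clearbody r; case/splitPr: jr r_uniq => p q.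
rewrite cat_uniq /= => /and4P[_ pj /negP jq _].
rewrite big_cat big_cons /= mulrA.
apply: (H I J _ (s 1%N) (s 2%N)) W0 => //; try exact: (sP _).1.
- move=> x y Ix [k /= kj ky] xy; apply/kj/once.
  by apply: (disjoint _ _ y) => //; rewrite -xy; exact: sI.
- move=> x y Ix Iy xy; suff : 1%N = 2%N by [].
  by apply: (disjoint _ _ (s 1%N x)); [|rewrite xy]; exact: sI.
- by apply: JP; apply: contra pj => jp; rewrite jp.
- by apply: JP; apply/negP.
Qed.

Lemma extended_weak_singleton_weak :
  extended_weak_singleton E -> weak_singleton E.
Proof.
move=> H n X i j once X0.
have actE l x : es_act E (swap 0 l) (es_iota E 0%N x) = es_iota E l x.
  by rewrite es_act_iota ?swapl //; exact: swap_bij.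
have -> : \prod_(k < n) es_iota E (i k) (X k) =
    \prod_(k < n) es_act E (swap 0 (i k)) (es_iota E 0%N (X k)).
  by apply: eq_bigr => k _; rewrite actE.
apply: (H [set 0%N] (fun l => [set l]) (fun l => swap 0 l) (swap 0)
  _ _ _ _ n _ i j) => //.
- by move=> l l' _ _ [x [-> ->]].
- move=> l; split => [x /= ->|x y|x /= ->]; first by rewrite swapl.
    by rewrite !inE => -> ->.
  by exists 0%N; rewrite ?swapl.
- by move=> l; split; first exact: swap_bij.
- move=> k; apply: generated_incl; exists 0%N => //.
- by rewrite !actE.
Qed.

End Exchangeability.

(** * The tracial case *)

Lemma star_sum (C : numClosedFieldType) (A : preCStarAlgType C) (K : Type)
    (r : seq K) (F : K -> A) :
  star (\sum_(k <- r) F k) = \sum_(k <- r) star (F k).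
Proof.
elim: r => [|k r IHr]; last by rewrite !big_cons starD IHr.
by rewrite !big_nil -(scale0r (0 : A)) starZ rmorph0 !scale0r.
Qed.

(** A nonnegative complex number is real, which brings the claim back to the
    archimedean property of [R]. *)
Lemma complex_archimedean_eq0 (R : realType) (a d : R[i]) :
  0 <= a -> (forall n : nat, n.+1%:R * a <= d) -> a = 0.
Proof.
rewrite lecE /= => /andP[/eqP Ima Rea] bound.
have aE : a = (complex.Re a)%:C%C.
  by apply/eqP; rewrite eq_complex /= Ima !eqxx.
rewrite aE; congr (_%:C)%C; apply/eqP; rewrite eq_le Rea andbT leNgt.
apply/negP => a_gt0.
have := bound (Num.Def.archi_bound `|complex.Re d / complex.Re a|).
rewrite aE -(rmorph_nat (real_complex R)) -rmorphM lecE /= => /andP[_].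
rewrite leNgt -ltr_pdivrMr // => /negP; apply.
apply: le_lt_trans (ler_norm _) _.
by apply: lt_trans (archi_boundP (normr_ge0 _)) _; rewrite ltr_nat.
Qed.

(** Infinitely many orthogonal vectors of equal length cannot have a common
    nonzero inner product with one vector: if [S] is the sum of [n] of them,
    Cauchy-Schwarz for [S] and [Y] reads
    [n ^ 2 * |z| ^ 2 <= n * d * phi (star Y * Y)]. *)
Lemma state_orthogonal_sequence (R : realType) (A : preCStarAlgType R[i])
    (phi : state A) (X : nat -> A) (Y : A) (d z : R[i]) :
    (forall m, phi (star (X m) * X m) = d) ->
    (forall m k, m <> k -> phi (star (X m) * X k) = 0) ->
    (forall m, phi (star (X m) * Y) = z) ->
  z = 0.
Proof.
move=> Xd X0 XY; apply/eqP; rewrite -normr_eq0 -sqrf_eq0; apply/eqP.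
apply: (@complex_archimedean_eq0 _ _ (d * phi (star Y * Y))).
  exact: exprn_ge0.
move=> n; set S := \sum_(m < n.+1) X m.
have SY : phi (star S * Y) = n.+1%:R * z.
  rewrite star_sum mulr_suml linear_sum /= (eq_bigr (fun=> z)) => [|m _].
    by rewrite sumr_const card_ord mulr_natl.
  exact: XY.
have SS : phi (star S * S) = n.+1%:R * d.
  rewrite star_sum mulr_suml linear_sum /= (eq_bigr (fun=> d)) => [|m _].
    by rewrite sumr_const card_ord mulr_natl.
  rewrite mulr_sumr linear_sum /= (bigD1 m) //= Xd big1 ?addr0 // => k km.
  by apply: X0 => mk; case/eqP: km; apply: val_inj.
have n0 : 0 < n.+1%:R :> R[i] by rewrite ltr0Sn.
rewrite -(ler_pM2l n0) [leRHS]mulrA -SS.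
have := state_cauchy_schwarz phi S Y; rewrite SY normrM normr_nat exprMn.
by rewrite expr2 -mulrA.
Qed.

Section Tracial.
Variables (R : realType) (A : preCStarAlgType R[i]) (phi : state A).
Variable E : exchangeability_system phi.

(** The blocks [d m] are images of [I] under [pickle (m, _)], shifted beyond
    [J]; this makes them pairwise disjoint and disjoint from [J]. *)
Lemma tracial_block_singleton : tracial (es_state E) -> block_singleton E.
Proof.
move=> tr I J s s1 s2 W Y Z finI finJ s_bij s1_bij s2_bij sIJ s12 IW JY JZ W0.
have [M ltM] := finite_set_lt finJ.
pose d (m x : nat) := (M + pickle (m, x))%N.
have d_inj m m' x x' : d m x = d m' x' -> (m, x) = (m', x').
  by move/addnI/(pcan_inj pickleK).
have dJ m x y : J y -> d m x <> y.
  by move=> /ltM yM dy; move: yM; rewrite -dy ltnNge leq_addr.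
have /choice[t tP] (m : nat) : exists t : nat -> nat, [/\ bijective t,
    forall x, I x -> t (s x) = d m x & forall y, J y -> t y = y].
  have [||x y _|t t_bij [tI tJ]] := two_block_permutation (g := d m) (g' := id)
    finI finJ (bij_inj s_bij) (@inj_id _) _ _ sIJ.
  - by move=> x y /d_inj[].
  - by [].
  - exact: dJ.
  by exists t.
pose X m := es_act E (t m \o s) W.
have tact m : X m = es_act E (t m) (es_act E s W).
  by apply: es_act_comp => //; have [] := tP m.
have JZY : es_subalgebra J (Z * Y) by exact: generatedM.
rewrite tr mulrA -[Z * Y]starK state_conj.
suff -> : es_state E (star (es_act E s W) * star (Z * Y)) = 0 by rewrite conjC0.
apply: (@state_orthogonal_sequence _ _ (es_state E) X (star (Z * Y))
  (es_state E (star (es_act E s W) * es_act E s W))).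
- move=> m; have [t_bij _ _] := tP m.
  by rewrite -[RHS](es_act_state t_bij) rmorphM /= es_act_star // tact.
(* Some permutation takes the blocks of [s1] and [s2] to those of [X m] and
   [X k], so orthogonality is the hypothesis on [W]. *)
- move=> m k mk; have [[tm_bij tmI _] [tk_bij tkI _]] := (tP m, tP k).
  have ms_bij := bij_comp tm_bij s_bij; have ks_bij := bij_comp tk_bij s_bij.
  have [|r r_bij [r1 r2]] := two_block_permutation finI finI (bij_inj s1_bij)
    (bij_inj s2_bij) (bij_inj ms_bij) (bij_inj ks_bij) s12.
    by move=> x y Ix Iy /=; rewrite tmI // tkI // => /d_inj[].
  rewrite -(es_act_state r_bij) in W0; rewrite -W0 rmorphM /= es_act_star //.
  rewrite -!es_act_comp // /X.
  congr (es_state E (star _ * _)); symmetry; apply: es_act_eq IW => //.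
  + exact: bij_comp.
  + exact: bij_comp.
- move=> m; have [t_bij _ tJ] := tP m.
  rewrite -[RHS](es_act_state t_bij) rmorphM /= !es_act_star // tact.
  by rewrite (es_act_fix t_bij tJ JZY).
Qed.

End Tracial.

(** * Spans and conditional expectations *)

(** Additive combinations are enough below: the generating sets are stable under
    scalars, which are absorbed in the coefficient from [B]. *)
Inductive additive_span (V : nmodType) (S : set V) : set V :=
| additive_span0 : additive_span S 0
| additive_spanD u v : S u -> additive_span S v -> additive_span S (u + v).

Section AdditiveSpan.
Variables (V : nmodType) (S : set V).

Lemma additive_span_incl : S `<=` additive_span S.
Proof.
by move=> u Su; rewrite -[u]addr0; apply/additive_spanD/additive_span0.
Qed.

Lemma additive_span_add u v :
  additive_span S u -> additive_span S v -> additive_span S (u + v).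
Proof.
move=> Su Sv; elim: Su => [|x y Sx _ IH]; rewrite ?add0r // -addrA.
exact: additive_spanD.
Qed.

Lemma additive_span_min (T : set V) : T 0 ->
    (forall u v, T u -> T v -> T (u + v)) -> S `<=` T ->
  additive_span S `<=` T.
Proof.
by move=> T0 TD ST u; elim=> // x y /ST Tx _ Ty; exact: TD.
Qed.

End AdditiveSpan.

Section ConditionalExpectation.
Variables (C : numClosedFieldType) (B A : preCStarAlgType C).
Variable psi : cond_expectation B A.

Lemma ce_mull b x : psi (ce_incl psi b * x) = b * psi x.
Proof. by rewrite -[_ * x]mulr1 -(rmorph1 (ce_incl psi)) ce_bimodule mulr1. Qed.

Lemma ce_mulr x b : psi (x * ce_incl psi b) = psi x * b.
Proof.
by rewrite -[x]mul1r -(rmorph1 (ce_incl psi)) ce_bimodule !mul1r rmorph1 mul1r.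
Qed.

Lemma ce_inclK b : psi (ce_incl psi b) = b.
Proof. by rewrite -[ce_incl psi b]mulr1 ce_mull ce_unital mulr1. Qed.

Section FaithfulState.
Variables (phi : state A) (phiB : state B).
Hypothesis phi_faithful : faithful phi.
Hypothesis phiE : forall x, phi x = phiB (psi x).

Lemma faithful_base : faithful phiB.
Proof.
move=> b b0; have [inclS incl_inj] := ce_incl_embedding psi.
apply: incl_inj; rewrite rmorph0; apply: phi_faithful.
by rewrite -inclS -rmorphM phiE ce_inclK.
Qed.

(** For [b = star c] with [c = psi x - psi y] the hypothesis reads
    [phiB (star c * c) = 0], and [phiB] is faithful. *)
Lemma ce_unique x y :
    (forall b, phi (ce_incl psi b * x) = phi (ce_incl psi b * y)) ->
  psi x = psi y.
Proof.
move=> xy; apply/subr0_eq/faithful_base; set b := star _.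
by rewrite mulrBr linearB /= -!ce_mull -!phiE xy subrr.
Qed.

(** As [phi] and [phiB] are hermitian, the two sides have the same pairings with
    [B] under [phi]. *)
Lemma ce_star x : psi (star x) = star (psi x).
Proof.
have [inclS _] := ce_incl_embedding psi.
rewrite -[RHS]ce_inclK; apply: ce_unique => b.
rewrite -[b]starK inclS -starM state_star phiE ce_mulr -state_star.
by rewrite starM phiE -inclS -rmorphM ce_inclK.
Qed.

End FaithfulState.
End ConditionalExpectation.

(** * Freeness of grouped algebras *)

Section FreeProduct.
Variables (C : numClosedFieldType) (I : eqType) (B A U : preCStarAlgType C).
Variables (psi : cond_expectation B A) (Psi : cond_expectation B U).
Variable iota : I -> {lrmorphism A -> U}.
Hypothesis afp : amalgamated_free_product (fun _ : I => psi) Psi iota.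
Implicit Types (w : seq (I * A)) (L : seq I) (J K : set I) (u v : U).

Local Notation incl := (ce_incl Psi).
Local Notation alternating := (sorted [rel i j | i != j]).

(** Words are lists of pairs (index, element of [A]), so that the index pattern
    of a product is the list of first components. *)
Definition eval_word w : U := \prod_(a <- w) iota a.1 a.2.

Definition centered w := all (fun a => psi a.2 == 0) w.

Lemma eval_cons a w : eval_word (a :: w) = iota a.1 a.2 * eval_word w.
Proof. exact: big_cons. Qed.

Lemma ce_alternating_word w : alternating (map fst w) -> w != [::] ->
  centered w -> Psi (eval_word w) = 0.
Proof.
case: w => // a w /(sortedP a.1) walt _ /(all_nthP a) wc.
rewrite /eval_word (big_nth a) big_mkord.
apply: (afp_free afp (i := fun k => (nth a (a :: w) k).1)
  (X := fun k => (nth a (a :: w) k).2)) => [k l kl|k].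
  have := walt k; rewrite size_map -kl => /(_ (ltn_ord l)).
  by rewrite !(nth_map a) ?ltn_ord // => /eqP.
exact/eqP/(wc _ (ltn_ord k)).
Qed.

(** A coefficient from [B] on the right of a nonempty word is swallowed by its
    last letter, which stays centered by the bimodule property. *)
Lemma centered_absorb w b : w != [::] -> centered w ->
  exists w', [/\ map fst w' = map fst w, centered w' &
    eval_word w * incl b = eval_word w'].
Proof.
elim: w => // -[i x] w IHw _ /= /andP[/= /eqP x0 wc].
have [->|w_neq0] := eqVneq w [::].
  exists [:: (i, x * ce_incl psi b)]; split=> //=.
    by rewrite ce_mulr x0 mul0r eqxx.
  by rewrite /eval_word !big_seq1 rmorphM /= (afp_amalgamated afp i).
have [w' [w'E w'c ww']] := IHw w_neq0 wc.
exists ((i, x) :: w'); split; rewrite /= ?w'E // ?x0 ?eqxx //.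
by rewrite !eval_cons -mulrA ww'.
Qed.

(** The index list [L] is kept as a parameter because it is all that freeness
    looks at: products of monomials concatenate these lists. *)
Definition monomials L : set U := [set u | exists b w,
  [/\ map fst w = L, centered w & u = incl b * eval_word w]].

Lemma monomialsM L L' u v :
  monomials L u -> monomials L' v -> monomials (L ++ L') (u * v).
Proof.
move=> [b [w [<- wc ->]]] [b' [w' [<- w'c ->]]].
have [->|w_neq0] := eqVneq w [::].
  exists (b * b'), w'; split=> //=.
  by rewrite /eval_word big_nil mulr1 rmorphM mulrA.
have [w1 [<- w1c ww1]] := centered_absorb b' w_neq0 wc.
exists b, (w1 ++ w'); split; first exact: map_cat.
  by rewrite /centered all_cat; apply/andP.
by rewrite /eval_word big_cat mulrA -(mulrA (incl b)) ww1 mulrA.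
Qed.

Lemma ce_monomials L u :
  alternating L -> L != [::] -> monomials L u -> Psi u = 0.
Proof.
move=> Lalt L_neq0 [b [w [wL wc ->]]].
rewrite ce_mull ce_alternating_word ?mulr0 ?wL //.
by apply: contra L_neq0; rewrite -wL => /eqP ->.
Qed.

Definition reduced J : set U := [set u | exists L,
  [/\ alternating L, forall i, i \in L -> J i & monomials L u]].

Definition reduced_centered J : set U := [set u | exists L,
  [/\ alternating L, forall i, i \in L -> J i, L != [::] & monomials L u]].

(** Splitting the first letter as [x = (x - psi x) + psi x] gives a longer
    centered word plus a multiple of [w] by an element of [B]. *)
Lemma reduced_span_cons J i x w : J i ->
    alternating (i :: map fst w) -> (forall k, k \in map fst w -> J k) ->
    centered w ->
  additive_span (reduced J) (iota i x * eval_word w).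
Proof.
move=> Ji walt wJ wc.
have -> : iota i x * eval_word w =
    incl 1 * eval_word ((i, x - ce_incl psi (psi x)) :: w) +
    incl (psi x) * eval_word w.
  by rewrite rmorph1 mul1r eval_cons /= -(afp_amalgamated afp i) -mulrDl
    -rmorphD subrK.
apply: additive_span_add; apply: additive_span_incl.
  exists (i :: map fst w); split=> //.
    by move=> k; rewrite inE => /predU1P[->|/wJ].
  exists 1, ((i, x - ce_incl psi (psi x)) :: w); split=> //=.
  by rewrite linearB /= ce_inclK subrr eqxx.
exists (map fst w); split=> //; first exact: path_sorted walt.
by exists (psi x), w.
Qed.

(** The coefficient of a monomial merges with [x] on its left.  If the word
    starts with the index [i], its first letter merges as well; in either case
    [reduced_span_cons] applies. *)
Lemma reduced_span_mull J i x v : J i ->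
  additive_span (reduced J) v -> additive_span (reduced J) (iota i x * v).
Proof.
move=> Ji; apply: (@additive_span_min _ _
  (fun v => additive_span (reduced J) (iota i x * v))).
- by rewrite mulr0; exact: additive_span0.
- by move=> u {}v Ju Jv; rewrite mulrDr; exact: additive_span_add.
move=> u [L [walt wJ [b [w [wL wc ->]]]]].
move: walt wJ; rewrite -{}wL => walt wJ.
rewrite mulrA -(afp_amalgamated afp i) -rmorphM.
case: w => [|[k y] w] /= in walt wJ wc *; first exact: reduced_span_cons.
have [ki|ki] := eqVneq k i; last first.
  apply: reduced_span_cons => //=.
  by rewrite eq_sym ki.
rewrite -ki eval_cons mulrA -rmorphM.
apply: reduced_span_cons => //=; first by rewrite ki.
  by move=> j jw; apply: wJ; rewrite inE jw orbT.
by case/andP: wc.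
Qed.

(** The [u] that map the span of the reduced monomials into itself by left
    multiplication form a subalgebra, which contains the generators; then
    apply [u] to [1]. *)
Lemma free_generated_reduced J u :
    generated_subalgebra (\bigcup_(i in J) range (iota i)) u ->
  additive_span (reduced J) u.
Proof.
move=> Ju.
suff mull v :
    additive_span (reduced J) v -> additive_span (reduced J) (u * v).
  rewrite -[u]mulr1; apply/mull/additive_span_incl.
  exists [::]; split=> //; exists 1, [::]; split=> //.
  by rewrite /eval_word big_nil rmorph1 mulr1.
move: u Ju v; apply: generated_min.
- by move=> v; rewrite mul1r.
- move=> a u v IHu IHv x Jx; rewrite mulrDl -scalerAl.
  apply: additive_span_add; last exact: IHv.
  rewrite scalerAr; apply: IHu; move: x Jx.
  apply: additive_span_min => [|x y|x].
  + by rewrite scaler0; exact: additive_span0.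
  + by rewrite scalerDr; exact: additive_span_add.
  move=> [L [Lalt LJ [b [w [wL wc ->]]]]]; apply: additive_span_incl.
  exists L; split=> //; exists (a *: b), w; split=> //.
  by rewrite linearZ -scalerAl.
- by move=> u v IHu IHv x Jx; rewrite -mulrA; apply/IHu/IHv.
- by move=> _ [i Ji [x _ <-]] v; exact: reduced_span_mull.
Qed.

(** [Psi] picks out the part of a sum of reduced monomials that comes from the
    empty word. *)
Lemma reduced_span_center J u : additive_span (reduced J) u ->
  additive_span (reduced_centered J) (u - incl (Psi u)).
Proof.
move: u; apply: additive_span_min.
- by rewrite linear0 rmorph0 subr0; exact: additive_span0.
- move=> u v; rewrite linearD rmorphD opprD addrACA.
  exact: additive_span_add.
move=> u [L [Lalt LJ Lu]]; have [L0|L_neq0] := eqVneq L [::]; last first.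
  rewrite (ce_monomials Lalt L_neq0 Lu) rmorph0 subr0.
  by apply: additive_span_incl; exists L.
move: Lu; rewrite L0 => -[b [[|a w] []]] // _ _ ->.
rewrite /eval_word big_nil mulr1 ce_inclK subrr; exact: additive_span0.
Qed.

Lemma alternating_cat L i L' : alternating L -> alternating (i :: L') ->
  i \notin L -> alternating (L ++ i :: L').
Proof.
case: L => // j L; rewrite /= cat_path /= => -> -> iL; rewrite andbT.
by apply: contraNneq iL => <-; exact: mem_last.
Qed.

(** By multilinearity the three factors are monomials.  Their concatenation is
    alternating because [J] and [K] are disjoint and the middle word, coming
    from the centered [y], is nonempty. *)
Lemma ce_centered_sandwich J K x y z : J `&` K = set0 ->
    additive_span (reduced J) x -> additive_span (reduced_centered K) y ->
    additive_span (reduced J) z ->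
  Psi (x * y * z) = 0.
Proof.
move=> JK Jx Ky Jz.
have notJK i : J i -> K i -> False.
  by move=> Ji Ki; have : (J `&` K) i by []; rewrite JK.
move: x Jx; apply: additive_span_min.
- by rewrite !mul0r linear0.
- by move=> u v u0 v0; rewrite !mulrDl linearD /= u0 v0 addr0.
move=> x [L1 [L1alt L1J L1x]].
move: y Ky; apply: additive_span_min.
- by rewrite mulr0 mul0r linear0.
- by move=> u v u0 v0; rewrite mulrDr mulrDl linearD /= u0 v0 addr0.
move=> y [[|i L2] []] // L2alt L2K _ L2y.
move: z Jz; apply: additive_span_min.
- by rewrite mulr0 linear0.
- by move=> u v u0 v0; rewrite mulrDr linearD /= u0 v0 addr0.
move=> z [L3 [L3alt L3J L3z]].
have iL1 : i \notin L1.
  by apply/negP => /L1J Ji; apply: notJK Ji (L2K _ (mem_head _ _)).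
apply: ce_monomials (monomialsM (monomialsM L1x L2y) L3z).
  have L23alt : alternating (i :: (L2 ++ L3)).
    case: L3 L3alt L3J {L3z} => [|j L3] L3alt L3J; first by rewrite cats0.
    apply: (@alternating_cat (i :: L2)) => //; apply/negP => /L2K.
    by apply: notJK; apply: L3J; exact: mem_head.
  by rewrite -catA; exact: alternating_cat.
by case: (L1).
Qed.

Lemma ce_free_sandwich J K x y z : J `&` K = set0 ->
    generated_subalgebra (\bigcup_(i in J) range (iota i)) x ->
    generated_subalgebra (\bigcup_(i in K) range (iota i)) y ->
    generated_subalgebra (\bigcup_(i in J) range (iota i)) z ->
  Psi y = 0 -> Psi (x * y * z) = 0.
Proof.
move=> JK Jx Ky Jz y0.
apply: ce_centered_sandwich JK _ _ _; try exact: free_generated_reduced.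
have := reduced_span_center (free_generated_reduced Ky).
by rewrite y0 rmorph0 subr0.
Qed.

(** Write [y] as its centered part plus [Psi y] and apply
    [ce_centered_sandwich] with [z = 1]. *)
Lemma ce_free_mul J K x y : J `&` K = set0 ->
    generated_subalgebra (\bigcup_(i in J) range (iota i)) x ->
    generated_subalgebra (\bigcup_(i in K) range (iota i)) y ->
  Psi (x * y) = Psi x * Psi y.
Proof.
move=> JK Jx Ky.
rewrite -[y in LHS](subrK (incl (Psi y))) mulrDr linearD /= ce_mulr.
rewrite -[x * _]mulr1 (ce_centered_sandwich JK) ?add0r //.
- exact: free_generated_reduced.
- exact/reduced_span_center/free_generated_reduced.
- by apply: free_generated_reduced; exact: generated1.
Qed.

End FreeProduct.

(** * The amalgamated free product case *)

Section AmalgamatedFree.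
Variables (C : numClosedFieldType) (A : preCStarAlgType C) (phi : state A).
Variable E : exchangeability_system phi.

(** [Psi W] does not change under permutations, so the hypothesis on two
    translates of [W] becomes [phiB (star (Psi W) * Psi W) = 0]. *)
Lemma free_block_singleton : faithful (es_state E) ->
  from_amalgamated_free_product E -> block_singleton E.
Proof.
move=> phi_faithful [B [psi [Psi [phiB [afp _ phiE]]]]].
have Psi_act s u : bijective s -> Psi (es_act E s u) = Psi u.
  move=> s_bij; apply: (ce_unique phi_faithful phiE) => b.
  have -> : ce_incl Psi b = es_act E s (ce_incl Psi b).
    by rewrite -(afp_amalgamated afp 0%N) es_act_iota // !(afp_amalgamated afp).
  by rewrite -rmorphM es_act_state // -(afp_amalgamated afp 0%N)
    es_act_iota // !(afp_amalgamated afp).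
move=> I J s s1 s2 W Y Z _ _ s_bij s1_bij s2_bij sIJ s12 IW JY JZ W0.
have disjoint (K L : set nat) :
    (forall x, K x -> L x -> False) -> K `&` L = set0.
  by move=> KL; apply/seteqP; split=> // x [/KL].
have PsiW : Psi W = 0.
  apply: (faithful_base phi_faithful phiE).
  rewrite -(ce_star phi_faithful phiE) -(Psi_act s1 (star W)) //.
  rewrite -(Psi_act s2 W) //.
  rewrite -(ce_free_mul afp (J := s1 @` I) (K := s2 @` I)) -?phiE
    ?es_act_star //.
  - by apply: disjoint => _ [x Ix <-] [y Iy] /esym /(s12 _ _ Ix Iy).
  - rewrite -es_act_star //; apply: es_act_subalgebra => //.
    exact: es_subalgebra_star.
  - exact: es_act_subalgebra.
rewrite phiE (ce_free_sandwich afp (J := J) (K := s @` I)) ?linear0 ?Psi_act //.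
- by apply: disjoint => x Jx [y Iy]; exact: sIJ.
- exact: es_act_subalgebra.
Qed.

End AmalgamatedFree.

Theorem proposition1p17 (R : realType) (A : preCStarAlgType R[i])
    (phi : state A) (E : exchangeability_system phi) :
  (faithful (es_state E) /\ from_amalgamated_free_product E ->
     weak_singleton E /\ extended_weak_singleton E)
  /\
  (tracial (es_state E) ->
     weak_singleton E /\ extended_weak_singleton E).
Proof.
have block_suffices :
    block_singleton E -> weak_singleton E /\ extended_weak_singleton E.
  move=> /block_singleton_extended ext.
  by split=> //; exact: extended_weak_singleton_weak.
split=> [[phi_faithful phi_free]|phi_tracial]; apply: block_suffices.
  exact: free_block_singleton.
exact: tracial_block_singleton.
Qed.
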